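(* Let $I\subseteq\mathbb{R}$ be an open interval and let $p,\bar p,\bar q:I\to\mathbb{R}$ be functions with $p$ and $\bar p$ differentiable. Let $z:I\to\mathbb{R}$ be a twice differentiable solution of $$z''(x)+\bar p(x)z'(x)+\bar q(x)z(x)=0$$ on $I$, and let $$g(x)=\exp\left(\frac12\int\left(p(x)-\bar p(x)\right)dx\right),$$ where $\int(p(x)-\bar p(x))\,dx$ denotes an antiderivative of $p-\bar p$ on $I$. Define $y:I\to\mathbb{R}$ by $z(x)=g(x)y(x)$. Then $y$ satisfies on $I$ the equation $$y''(x)+p(x)y'(x)+\left(\frac12\left(p(x)-\bar p(x)\right)'+\frac{p^2(x)-\bar p^2(x)}{4}+\bar q(x)\right)y(x)=0 .$$ In particular, the equation for $z$ can be made conjugate to any equation of the form $y''+p\,y'+q\,y=0$ whose first-order coefficient is $p$.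
   Context: Two equations of the form $y''+p\,y'+q\,y=0$ are called conjugate if they have the same coefficient $p$ of the first-derivative term (the coefficients $q$ of the zeroth-order term being different in general). *)

(* Defs.v *)
From Stdlib Require Import Reals.
From Coquelicot Require Import Coquelicot.
Open Scope R_scope.

(** The open interval (a, b), bounded or not.  A function on it is a total
    [R -> R] whose values elsewhere are irrelevant: at a point of an open set,
    [ex_derive] and [Derive] depend only on the values in that set. *)
Definition open_itv (a b : Rbar) (x : R) : Prop := Rbar_lt a x /\ Rbar_lt x b.

Definition differentiable_on (D : R -> Prop) (f : R -> R) : Prop :=
  forall x, D x -> ex_derive f x.

Definition twice_differentiable_on (D : R -> Prop) (f : R -> R) : Prop :=
  differentiable_on D f /\ differentiable_on D (Derive f).

Definition antiderivative_on (D : R -> Prop) (f F : R -> R) : Prop :=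
  forall x, D x -> is_derive F x (f x).

(** The equation y'' + [coef1] y' + [coef0] y = 0. *)
Record lin_ode2 : Type := LinODE2 { coef1 : R -> R; coef0 : R -> R }.

Definition solution_on (D : R -> Prop) (E : lin_ode2) (y : R -> R) : Prop :=
  twice_differentiable_on D y /\
  forall x, D x ->
    Derive_n y 2 x + coef1 E x * Derive y x + coef0 E x * y x = 0.

Definition conjugate_on (D : R -> Prop) (E1 E2 : lin_ode2) : Prop :=
  forall x, D x -> coef1 E1 x = coef1 E2 x.

(** The change of unknown z = g y turns E (for z) into E' (for y). *)
Definition turns_into (D : R -> Prop) (g : R -> R) (E E' : lin_ode2) : Prop :=
  (forall x, D x -> g x <> 0) /\
  forall z y : R -> R, (forall x, D x -> z x = g x * y x) ->
    (solution_on D E z <-> solution_on D E' y).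

(* Main.v *)
(** Put [h = (p - pbar) / 2], so that [g' = h g] and
    [z'' + pbar z' + qbar z = g (y'' + (pbar + 2 h) y' + (h' + h^2 + pbar h + qbar) y)]
    as soon as [y] is twice differentiable.  Here [pbar + 2 h = p] and
    [h^2 + pbar h = (p^2 - pbar^2) / 4], and [g] never vanishes.  The regularity
    of [y] follows from that of [z] since [y = g^-1 z], where [g^-1] is built
    from the antiderivative [- G] in the same way as [g] from [G]. *)
Require Import Defs.
From Stdlib Require Import Reals.
From Coquelicot Require Import Coquelicot.
Open Scope R_scope.

Lemma open_open_itv (a b : Rbar) : open (open_itv a b).
Proof.
apply open_and; [apply open_Rbar_gt | apply open_Rbar_lt].
Qed.

Lemma open_itv_convex (a b : Rbar) (c x t : R) :
  open_itv a b c -> open_itv a b x -> Rmin c x <= t <= Rmax c x ->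
  open_itv a b t.
Proof.
intros [ac cb] [ax xb] [Hm HM]; split.
- apply Rbar_lt_le_trans with (Rmin c x); [|exact Hm].
  now apply Rmin_case.
- apply Rbar_le_lt_trans with (Rmax c x); [exact HM|].
  now apply Rmax_case.
Qed.

(** By the fundamental theorem of calculus, the integral from a fixed base point works: convexity
    keeps the segment of integration inside the interval, where [f] is continuous. *)
Lemma continuous_antiderivative_on (a b : Rbar) (f : R -> R) :
  (forall x, open_itv a b x -> continuous f x) ->
  exists F : R -> R, antiderivative_on (open_itv a b) f F.
Proof.
intros Hf.
(* The endpoints are not assumed ordered, so the interval may be empty and offer no base point. *)
destruct (Classical_Prop.classic (exists c, open_itv a b c)) as [[c Hc]|Hempty].
- exists (RInt f c); intros x Hx.
  apply is_derive_RInt with c; [|now apply Hf].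
  (* The integral must exist for every upper limit near [x], not only for [x] itself. *)
  apply filter_imp with (open_itv a b); [|now apply open_open_itv].
  intros y Hy; apply (@RInt_correct R_CompleteNormedModule).
  apply (@ex_RInt_continuous R_CompleteNormedModule).
  intros t Ht; apply Hf; now apply open_itv_convex with c y.
- exists (fun _ => 0); intros x Hx; exfalso; apply Hempty; now exists x.
Qed.

(** This is the product rule, with the exponential kept as a left factor: the derivative has the
    same shape as [v], so the lemma can be applied again to [Derive v]. *)
Lemma derive_exp_half_antiderivative (D : R -> Prop) (f F u v : R -> R) :
  open D -> antiderivative_on D f F -> differentiable_on D u ->
  (forall x, D x -> v x = exp (1 / 2 * F x) * u x) ->
  forall x, D x ->
    is_derive v x (exp (1 / 2 * F x) * (Derive u x + 1 / 2 * f x * u x)).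
Proof.
intros oD HF Hu Hv x Dx.
apply is_derive_ext_loc with (fun x => exp (1 / 2 * F x) * u x).
- apply filter_imp with D; [|now apply oD].
  intros t Dt; now rewrite Hv.
- pose proof (HF x Dx) as HFx.
  auto_derive.
  + repeat split; [now exists (f x) | now apply Hu].
  + replace (Derive (fun x0 => F x0) x) with (f x)
      by (symmetry; now apply is_derive_unique).
    change (Derive (fun x0 => u x0) x) with (Derive u x); field.
Qed.

Section ExpHalfProduct.

Variables (D : R -> Prop) (f F u v : R -> R).
Hypotheses (oD : open D) (Hf : differentiable_on D f).
Hypothesis HF : antiderivative_on D f F.
Hypothesis Hu : twice_differentiable_on D u.
Hypothesis Hv : forall x, D x -> v x = exp (1 / 2 * F x) * u x.

(** The cofactor of the exponential after one differentiation: multiplication by the exponential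
    turns d/dx into d/dx + f/2. *)
Let du x := Derive u x + 1 / 2 * f x * u x.

Let is_derive_du x : D x ->
  is_derive du x
    (Derive (Derive u) x + 1 / 2 * Derive f x * u x + 1 / 2 * f x * Derive u x).
Proof.
intros Dx; destruct Hu as [Hu1 Hu2]; unfold du.
auto_derive.
- repeat split; [now apply Hu2 | now apply Hf | now apply Hu1].
- change (Derive (fun x => u x) x) with (Derive u x).
  change (Derive (fun x => f x) x) with (Derive f x).
  change (Derive (fun x => Derive u x) x) with (Derive (Derive u) x).
  ring.
Qed.

Let is_derive_v x : D x -> is_derive v x (exp (1 / 2 * F x) * du x).
Proof.
exact (derive_exp_half_antiderivative D f F u v oD HF (proj1 Hu) Hv x).
Qed.

Let Derive_v x : D x -> Derive v x = exp (1 / 2 * F x) * du x.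
Proof. intros Dx; now apply is_derive_unique, is_derive_v. Qed.

Let is_derive_Derive_v x : D x ->
  is_derive (Derive v) x
    (exp (1 / 2 * F x) * (Derive du x + 1 / 2 * f x * du x)).
Proof.
(* Second application of the product rule, with [du] in the role of [u] and [Derive v] in that of
   [v]. *)
apply (derive_exp_half_antiderivative D f F du (Derive v) oD HF); [|exact Derive_v].
intros t Dt; eexists; now apply is_derive_du.
Qed.

Lemma twice_differentiable_exp_half_mul : twice_differentiable_on D v.
Proof.
split; intros x Dx; eexists; [now apply is_derive_v | now apply is_derive_Derive_v].
Qed.

Lemma Derive_exp_half_mul x : D x ->
  Derive v x = exp (1 / 2 * F x) * (Derive u x + 1 / 2 * f x * u x).
Proof. exact (Derive_v x). Qed.

(** The bracket is the square of the operator d/dx + f/2 applied to [u]; the term f'/2 arises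
    because d/dx also acts on f/2. *)
Lemma Derive_n_2_exp_half_mul x : D x ->
  Derive_n v 2 x =
    exp (1 / 2 * F x) *
    (Derive_n u 2 x + f x * Derive u x
     + (1 / 2 * Derive f x + 1 / 4 * f x ^ 2) * u x).
Proof.
intros Dx.
change (Derive (Derive v) x = exp (1 / 2 * F x) *
  (Derive (Derive u) x + f x * Derive u x
   + (1 / 2 * Derive f x + 1 / 4 * f x ^ 2) * u x)).
rewrite (is_derive_unique _ _ _ (is_derive_Derive_v x Dx)).
rewrite (is_derive_unique _ _ _ (is_derive_du x Dx)).
unfold du; field.
Qed.

End ExpHalfProduct.

Lemma turns_into_exp_half (D : R -> Prop) (p pbar qbar G : R -> R) :
  open D -> differentiable_on D p -> differentiable_on D pbar ->
  antiderivative_on D (fun x => p x - pbar x) G ->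
  turns_into D (fun x => exp (1 / 2 * G x))
    (LinODE2 pbar qbar)
    (LinODE2 p (fun x =>
       1 / 2 * Derive (fun t => p t - pbar t) x
       + (p x ^ 2 - pbar x ^ 2) / 4 + qbar x)).
Proof.
intros oD Hp Hpbar HG.
assert (Hf : differentiable_on D (fun x => p x - pbar x)).
{ intros x Dx; apply (ex_derive_minus (V := R_NormedModule)); auto. }
split; [intros x _; apply Rgt_not_eq, exp_pos|].
intros z y Hzy.
(* Both directions use this identity. Regularity of [y] stays a premise because it is given in one
   direction only and must be derived in the other. *)
assert (Hop : twice_differentiable_on D y -> forall x, D x ->
  Derive_n z 2 x + pbar x * Derive z x + qbar x * z x =
  exp (1 / 2 * G x) *
  (Derive_n y 2 x + p x * Derive y x +
   (1 / 2 * Derive (fun t => p t - pbar t) x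
    + (p x ^ 2 - pbar x ^ 2) / 4 + qbar x) * y x)).
{ intros Hy x Dx.
  rewrite (Derive_n_2_exp_half_mul D _ G y z oD Hf HG Hy Hzy x Dx).
  rewrite (Derive_exp_half_mul D _ G y z oD HG Hy Hzy x Dx).
  rewrite (Hzy x Dx); field. }
split; intros [Hreg Heq].
- assert (Hy : twice_differentiable_on D y).
  (* The roles of [y] and [z] are exchanged, with [- G] as antiderivative of the opposite
     function. *)
  { apply (twice_differentiable_exp_half_mul D
      (fun x => - (p x - pbar x)) (fun x => - G x) z y oD).
    - intros x Dx; apply (ex_derive_opp (V := R_NormedModule)); now apply Hf.
    - intros x Dx; apply (is_derive_opp (V := R_NormedModule)); now apply HG.
    - exact Hreg.
    - intros x Dx; rewrite Hzy, <- Rmult_assoc, <- exp_plus by exact Dx.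
      replace (1 / 2 * - G x + 1 / 2 * G x) with 0 by ring.
      rewrite exp_0; ring. }
  split; [exact Hy|]; intros x Dx.
  apply Rmult_eq_reg_l with (exp (1 / 2 * G x)); [|apply Rgt_not_eq, exp_pos].
  rewrite Rmult_0_r.
  exact (eq_trans (eq_sym (Hop Hy x Dx)) (Heq x Dx)).
- split.
  + exact (twice_differentiable_exp_half_mul D _ G y z oD Hf HG Hreg Hzy).
  + intros x Dx; apply (eq_trans (Hop Hreg x Dx)).
    apply Rmult_eq_0_compat_l; exact (Heq x Dx).
Qed.

Theorem mainTheorem3 (a b : Rbar) (p pbar qbar : R -> R)
  (hp : differentiable_on (open_itv a b) p)
  (hpbar : differentiable_on (open_itv a b) pbar) :
  let I := open_itv a b in
  let E := LinODE2 pbar qbar in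
  let E' := LinODE2 p (fun x =>
    1 / 2 * Derive (fun t => p t - pbar t) x
    + (p x ^ 2 - pbar x ^ 2) / 4 + qbar x) in
  (forall z G y : R -> R,
     solution_on I E z ->
     antiderivative_on I (fun x => p x - pbar x) G ->
     (forall x, I x -> z x = exp (1 / 2 * G x) * y x) ->
     solution_on I E' y)
  /\
  (exists G : R -> R,
     antiderivative_on I (fun x => p x - pbar x) G /\
     turns_into I (fun x => exp (1 / 2 * G x)) E E' /\
     forall q : R -> R, conjugate_on I E' (LinODE2 p q)).
Proof.
intros I E E'.
assert (oI : open I) by apply open_open_itv.
split.
- intros z G y Hz HG Hzy.
  now apply (turns_into_exp_half I p pbar qbar G oI hp hpbar HG) with z.
(* Differentiability of [p] and [pbar] makes their difference continuous, which supplies [G]. *)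
- destruct (continuous_antiderivative_on a b (fun x => p x - pbar x)) as [G HG].
  { intros x Ix; apply (ex_derive_continuous (V := R_NormedModule)).
    apply (ex_derive_minus (V := R_NormedModule)); auto. }
  exists G; split; [exact HG|]; split.
  + now apply turns_into_exp_half.
  + intros q x _; reflexivity.
Qed.
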